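(* Let $N\ge1$, $u>0$, $D_1,\dots,D_N>0$, $\gamma_n=D_n/\sum_iD_i$. Suppose each $c_n:\mathbb{R}\to\mathbb{R}$ is continuous, satisfies $c_n(s)=0$ for $s\le0$, is convex and strictly increasing on $[0,\infty)$, and satisfies $\frac{\partial^+c_n(z)}{\partial z}\big|_{z=0}\ge\frac{\gamma_nu}{2}$. Among bid profiles satisfying $u\ge\frac{\sum_i b_i}{\sum_i D_i}$, there exists a unique price-anticipating equilibrium $(\mathbf{b}^a,d^a,p^a)$ of the game defined by $(Q_1,\dots,Q_N)$ in the voluntary demand response market. For this equilibrium, the vector $\mathbf{s}^a$ defined by $s_n^a=S_n(b_n^a,p^a)$ (together with $d^a$) is the unique optimal solution of $$\max_{\mathbf{s},d}\ ud-\frac{ud^2}{2\sum_nD_n}-\sum_n\hat c_n(s_n)\quad\text{s.t.}\quad\sum_ns_n=d,\quad d\ge0,\quad0\le s_n\le D_n\ (n=1,\dots,N),$$ where, for $s_n\ge0$, $$\hat c_n(s_n)=\frac12\Bigl(s_n\frac{\gamma_nu}{2}+c_n(s_n)\Bigr)+\frac12\int_0^{s_n}\sqrt{\Bigl(\frac{\gamma_nu}{2}-\frac{\partial^+c_n(z)}{\partial z}\Bigr)^2+2\,\frac{\partial^+c_n(z)}{\partial z}\,\frac{zu}{\sum_iD_i}}\;dz,$$ and $\hat c_n(s_n)=0$ for $s_n<0$.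
   Context: Voluntary demand response: $N$ tenants, tenant $n$ with reduction capacity $D_n$ and cost $c_n(s_n)$ of reducing $s_n$; the operator receives reward $u$ per unit of reduction. Supply function: $S_n(b_n,p)=D_n-\frac{b_n}{p}$ for bid $b_n\ge0$ and price $p>0$. If the total reduction is $d$, the clearing price is $p=\frac{\sum_ib_i}{\sum_iD_i-d}$. A profit-maximizing operator leads (by first-order optimality) to the price $p(\mathbf{b})=\sqrt{\frac{u\sum_ib_i}{\sum_iD_i}}$, and a price-anticipating tenant has payoff $p(\mathbf b)S_n(b_n,p(\mathbf b))-c_n(S_n(b_n,p(\mathbf b)))$, i.e. $$Q_n(b_n;\mathbf{b}_{-n})=\gamma_n\sqrt{\textstyle\sum_mb_m}\sqrt{u\textstyle\sum_iD_i}-b_n-c_n\!\left(D_n-\frac{b_n}{\sqrt{\sum_mb_m}}\sqrt{\frac{\sum_iD_i}{u}}\right),$$ defined for $\sum_mb_m>0$. A price-anticipating equilibrium is a triple $(\mathbf{b},d,p)$ with $\mathbf{b}\ge0$ such that $Q_n(b_n;\mathbf{b}_{-n})\ge Q_n(\bar b_n;\mathbf{b}_{-n})$ for all $n$ and all $\bar b_n\ge0$ for which this is defined; $p=\frac{\sum_ib_i}{\sum_iD_i-d}$; and $d\in\arg\max_{0\le d'\le\sum_iD_i}\Bigl(u-\frac{\sum_ib_i}{\sum_iD_i-d'}\Bigr)d'$. $\partial^+$ denotes right derivative. *)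

(* Defs.v *)
From HB Require Import structures.
From mathcomp Require Import all_boot all_order all_algebra.
From mathcomp Require Import all_classical all_reals all_analysis.

Set Implicit Arguments.
Unset Strict Implicit.
Unset Printing Implicit Defensive.

Import Order.TTheory GRing.Theory Num.Theory.
Import numFieldNormedType.Exports.

Local Open Scope classical_set_scope.
Local Open Scope ring_scope.

(* The value is meaningful only where the limit exists in R, as it does at
   every x >= 0 for a function that is convex and nondecreasing on [0, +oo[. *)
Definition right_deriv (R : realType) (f : R -> R) (x : R) : R :=
  lim ((h^-1 * (f (x + h) - f x)) @[h --> 0^'+]).

Definition share (R : realType) (N : nat) (D : 'I_N -> R) (n : 'I_N) : R :=
  D n / \sum_i D i.

Definition supply (R : realType) (N : nat) (D : 'I_N -> R) (n : 'I_N)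
    (bn p : R) : R :=
  D n - bn / p.

Definition clearing_price (R : realType) (N : nat) (D b : 'I_N -> R)
    (d : R) : R :=
  (\sum_i b i) / (\sum_i D i - d).

(* At full reduction d = \sum_i D i the clearing price is infinite (the bids
   have positive sum wherever this is used), so the profit there is -oo. *)
Definition operator_profit (R : realType) (N : nat) (u : R) (D b : 'I_N -> R)
    (d : R) : \bar R :=
  if d < \sum_i D i then (((u - clearing_price D b d) * d)%:E)%E else (-oo)%E.

(* [payoff u D c n b] is Q_n(b_n; b_{-n}); it is meaningful only when
   \sum_m b m > 0. *)
Definition payoff (R : realType) (N : nat) (u : R) (D : 'I_N -> R)
    (c : 'I_N -> R -> R) (n : 'I_N) (b : 'I_N -> R) : R :=
  share D n * Num.sqrt (\sum_m b m) * Num.sqrt (u * \sum_i D i) - b n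
  - c n (D n - b n / Num.sqrt (\sum_m b m) * Num.sqrt ((\sum_i D i) / u)).

Definition anticipating_equilibrium (R : realType) (N : nat) (u : R)
    (D : 'I_N -> R) (c : 'I_N -> R -> R) (b : 'I_N -> R) (d p : R) : Prop :=
  [/\ (forall n, 0 <= b n) /\ 0 < \sum_m b m,
      forall (n : 'I_N) (x : R), 0 <= x ->
        let b' : 'I_N -> R := [eta b with n |-> x] in
        0 < \sum_m b' m -> payoff u D c n b' <= payoff u D c n b,
      p = clearing_price D b d,
      0 <= d <= \sum_i D i &
      forall d', 0 <= d' <= \sum_i D i ->
        (operator_profit u D b d' <= operator_profit u D b d)%E].

Definition modified_cost (R : realType) (N : nat) (u : R) (D : 'I_N -> R)
    (c : 'I_N -> R -> R) (n : 'I_N) (s : R) : R :=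
  if s < 0 then 0 else
    1 / 2 * (s * (share D n * u / 2) + c n s)
    + 1 / 2 * \int[@lebesgue_measure R]_(z in `[0, s])
        Num.sqrt ((share D n * u / 2 - right_deriv (c n) z) ^+ 2
                  + 2 * right_deriv (c n) z * (z * u / \sum_i D i)).

Definition feasible (R : realType) (N : nat) (D s : 'I_N -> R) (d : R) : Prop :=
  [/\ \sum_n s n = d, 0 <= d & forall n, 0 <= s n <= D n].

Definition objective (R : realType) (N : nat) (u : R) (D : 'I_N -> R)
    (c : 'I_N -> R -> R) (s : 'I_N -> R) (d : R) : R :=
  u * d - u * d ^+ 2 / (2 * \sum_n D n) - \sum_n modified_cost u D c n (s n).

Definition optimal (R : realType) (N : nat) (u : R) (D : 'I_N -> R)
    (c : 'I_N -> R -> R) (s : 'I_N -> R) (d : R) : Prop :=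
  feasible D s d /\
  forall s' d', feasible D s' d' -> objective u D c s' d' <= objective u D c s d.

(* Main.v *)
Require Import Defs.
From HB Require Import structures.
From mathcomp Require Import all_boot all_order all_algebra.
From mathcomp Require Import all_classical all_reals all_analysis.
From mathcomp Require Import ring lra.

Set Implicit Arguments.
Unset Strict Implicit.
Unset Printing Implicit Defensive.

Import Order.TTheory GRing.Theory Num.Theory.
Import numFieldNormedType.Exports.

Local Open Scope classical_set_scope.
Local Open Scope ring_scope.

(** Write [T] for the total capacity, [tau = u / T] and [y = T - d] for the
    unserved capacity.  The operator's optimality reads [\sum_i b i = tau * y^2],
    so the price is [tau * y], the bids are [b n = tau * y * (D n - s n)], and a
    deviation of tenant [n] is described by the resulting [y'], with
    [s' = D n - y' + w / y'] for a constant [w >= 0] fixed by the other bids.  In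
    this variable the payoff [tau * y' * s' - c s'] is concave, and its
    first-order condition is a quadratic equation in [tau * y] whose larger root
    is the derivative of the modified cost at [s n].  Hence equilibria are the
    Karush-Kuhn-Tucker points of the strictly concave program.  Since the
    derivatives of the modified costs are strictly increasing, but possibly
    discontinuous, these conditions are expressed by thresholds: the derivative
    is at most [tau * y] before [s n] and at least [tau * y] after it.  The
    threshold is a continuous nondecreasing function of [y], so
    [y = \sum_n (D n - s n)] has exactly one solution. *)

(** * Convex functions on the half-line *)

(** Derivative estimates hold only on one side of a point where the derivative may jump; this lemma
    and the next carry their consequences to the point itself. *)
Lemma le_at_right_limit (R : realType) (f g : R -> R) (a b : R) :
  {for a, continuous f} -> {for a, continuous g} -> a < b ->
  (forall x, a < x < b -> f x <= g x) -> f a <= g a.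
Proof.
move=> cf cg ab fg.
have fl : f x @[x --> a^'+] --> f a by exact: cvg_within_filter cf.
have gl : g x @[x --> a^'+] --> g a by exact: cvg_within_filter cg.
apply: (ler_cvg_to fl gl).
near=> x; apply: fg; apply/andP; split; near: x; first exact: nbhs_right_gt.
  exact: nbhs_right_lt.
Unshelve. all: by end_near. Qed.

Lemma le_at_left_limit (R : realType) (f g : R -> R) (a b : R) :
  {for b, continuous f} -> {for b, continuous g} -> a < b ->
  (forall x, a < x < b -> f x <= g x) -> f b <= g b.
Proof.
move=> cf cg ab fg.
have fl : f x @[x --> b^'-] --> f b by exact: cvg_within_filter cf.
have gl : g x @[x --> b^'-] --> g b by exact: cvg_within_filter cg.
apply: (ler_cvg_to fl gl).
near=> x; apply: fg; apply/andP; split; near: x; first exact: nbhs_left_gt.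
  exact: nbhs_left_lt.
Unshelve. all: by end_near. Qed.

(** The chord inequality is multiplied out by [z - x], so that later uses are free of division. *)
Lemma convex_chord (R : realType) (c : R -> R) (x y z : R) :
  @convex_function R R^o [set x | 0 <= x] c ->
  0 <= x -> x < y -> y < z ->
  c y * (z - x) <= c x * (z - y) + c z * (y - x).
Proof.
move=> cvx x0 xy yz.
have zx : 0 < z - x by lra.
have t0 : 0 <= (z - y) / (z - x) by apply: divr_ge0; lra.
have t1 : (z - y) / (z - x) <= 1 by rewrite ler_pdivrMr//; lra.
have := cvx (Itv01 t0 t1) x z.
rewrite !inE/= => /(_ x0 (le_trans x0 (ltW (lt_trans xy yz)))).
set t := (z - y) / (z - x) => H.
have {}H : c (t * x + (1 - t) * z) <= t * c x + (1 - t) * c z := H.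
move: H; have -> : t * x + (1 - t) * z = y by rewrite /t; field; lra.
rewrite -(ler_pM2r zx) => /le_trans; apply.
by rewrite le_eqVlt; apply/orP; left; apply/eqP; rewrite /t; field; lra.
Qed.

(** By convexity the quotients [q s h] are nondecreasing in [h], and they are nonnegative because
    [c] increases, so the limit exists, also at 0. It is at most the quotient at [h = t - s], while
    every quotient at [t] is at least the slope from [s] to [t]. *)
Lemma convex_right_deriv_bounds (R : realType) (c : R -> R) :
  @convex_function R R^o [set x | 0 <= x] c ->
  (forall x y, 0 <= x -> x < y -> c x < c y) ->
  forall s t, 0 <= s -> s < t ->
    right_deriv c s * (t - s) <= c t - c s <= right_deriv c t * (t - s).
Proof.
move=> cvx inc.
pose q s h := h^-1 * (c (s + h) - c s).
have slope s h k : 0 <= s -> 0 < h -> h <= k -> q s h <= q s k.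
  move=> s0 h0; rewrite le_eqVlt => /predU1P[->//|hk].
  have k0 : 0 < k by lra.
  have := @convex_chord _ _ s (s + h) (s + k) cvx s0.
  move=> /(_ ltac:(lra) ltac:(lra)) H.
  rewrite /q -(ler_pM2l h0) mulrA divff ?lt0r_neq0// mul1r.
  rewrite -(ler_pM2r k0).
  have -> : h * (k^-1 * (c (s + k) - c s)) * k = h * (c (s + k) - c s).
    by field; lra.
  by lra.
have q0 s h : 0 <= s -> 0 < h -> 0 <= q s h.
  move=> s0 h0; rewrite /q mulr_ge0 ?invr_ge0 ?ltW//.
  by rewrite subr_gt0 inc//; lra.
have qcvg s : 0 <= s -> cvg (q s h @[h --> 0^'+]).
  move=> s0; apply: nondecreasing_at_right_is_cvgr; apply: nearW => x.
    move=> h k; rewrite !in_itv/= => /andP[h0 _] /andP[k0 _] hk.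
    exact: slope.
  by exists 0 => _ /= [h + <-]; rewrite in_itv/= => /andP[h0 _]; exact: q0.
move=> s t s0 st; have ts : 0 < t - s by lra.
have t0 : 0 <= t by lra.
apply/andP; split.
  rewrite -ler_pdivlMr// mulrC.
  apply: limr_le; first exact: qcvg.
  near=> h; have := slope s h (t - s) s0.
  rewrite {2}/q (addrC s) subrK; apply; near: h.
    exact: nbhs_right_gt.
  exact: nbhs_right_le.
rewrite -ler_pdivrMr//.
apply: limr_ge; first exact: qcvg.
near=> h; have h0 : 0 < h by near: h; exact: nbhs_right_gt.
have := @convex_chord _ _ s t (t + h) cvx s0 st.
move=> /(_ ltac:(lra)) H.
rewrite ler_pdivrMr// -(ler_pM2l h0).
have -> : h * (h^-1 * (c (t + h) - c t) * (t - s)) = (c (t + h) - c t) * (t - s).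
  by field; lra.
by lra.
Unshelve. all: by end_near. Qed.

(** * Modified costs *)

(** The difference is the integral over []s, t]], where [f] lies between [f s] and [f t]. *)
Lemma nondecreasing_Rintegral_bounds (R : realType) (f : R -> R) (s t : R) :
  (forall x y, 0 <= x -> x <= y -> f x <= f y) -> 0 <= s -> s < t ->
  f s * (t - s) <=
    \int[@lebesgue_measure R]_(z in `[0, t]) f z
    - \int[@lebesgue_measure R]_(z in `[0, s]) f z <= f t * (t - s).
Proof.
move=> fnd s0 st.
have t0 : 0 <= t by rewrite (le_trans s0)// ltW.
have mf : measurable_fun (`[0, t] : set R) f.
  (* Monotonicity is known on the half-line only; [f (max x 0)] is monotone everywhere and agrees
     with [f] on the interval. *)
  apply: (@eq_measurable_fun _ _ _ _ _ (fun x : R => f (Num.max x 0)) f).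
    by move=> x; rewrite inE/= in_itv/= => /andP[x0 _]; rewrite max_l.
  apply: measurable_realfun.nondecreasing_measurable; first exact: measurable_itv.
  move=> x y xy; apply: fnd; first by rewrite le_max lexx orbT.
  by rewrite ge_max !le_max xy lexx/= orbT.
have fin_t : (@lebesgue_measure R `[0%R, t] < +oo)%E.
  by rewrite lebesgue_measure_itv/= lte_fin; case: ifP; rewrite ?ltry// -EFinD ltry.
have fin_st : (@lebesgue_measure R `]s, t] < +oo)%E.
  by rewrite lebesgue_measure_itv/= lte_fin st -EFinD ltry.
have itf : (@lebesgue_measure R).-integrable `[0, t] (EFin \o f).
  apply: measurable_bounded_integrable => //.
  exists (Num.max `|f 0| `|f t|); split; first by rewrite realE le_max normr_ge0.
  move=> M HM x /=; rewrite in_itv/= => /andP[x0 xt].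
  have f0x := fnd _ _ (lexx 0) x0.
  have fxt := fnd _ _ x0 xt.
  apply: le_trans (ltW HM); rewrite le_max.
  have [fx|fx] := leP 0 (f x).
    by apply/orP; right; rewrite (ger0_norm fx) (le_trans fxt) ?ler_norm.
  by apply/orP; left; rewrite (ltr0_norm fx) -normrN (le_trans _ (ler_norm _))// lerN2.
rewrite (Rintegral_itvB itf); last 2 first.
- by rewrite bnd_simp.
- by rewrite bnd_simp ltW.
have mst : measurable (`]s, t] : set R) by exact: measurable_itv.
have sub : `]s, t] `<=` (`[0, t] : set R).
  move=> x /=; rewrite !in_itv/= => /andP[sx ->]; rewrite andbT.
  by rewrite (le_trans s0)// ltW.
have itf' : (@lebesgue_measure R).-integrable `]s, t] (EFin \o f).
  by apply: integrableS itf => //; exact: measurable_itv.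
have mustE : fine (@lebesgue_measure R `]s, t]) = t - s.
  by rewrite lebesgue_measure_itv/= lte_fin st.
have itc (r : R) : (@lebesgue_measure R).-integrable `]s, t] (EFin \o cst r).
  apply: measurable_bounded_integrable => //.
  exists `|r|; split; first by rewrite realE normr_ge0.
  by move=> M HM x _; exact: ltW.
have cstE (r : R) : \int[@lebesgue_measure R]_(_ in `]s, t]) r = r * (t - s).
  by rewrite -mustE; apply: Rintegral_cst.
rewrite -!cstE; apply/andP; split.
  apply: le_Rintegral => //; first exact: itc.
  by move=> x /=; rewrite in_itv/= => /andP[sx _]; apply: fnd => //; exact: ltW.
apply: le_Rintegral => //; first exact: itc.
move=> x /=; rewrite in_itv/= => /andP[sx xt].
by apply: fnd => //; rewrite (le_trans s0)// ltW.
Qed.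

(* [marginal a x g] is the larger root in [v] of
   [v * (2 v - 2 a) = g * (2 v - 2 a + x)], a tenant's first-order condition
   at price [v = u y / T]. *)
Definition marginal (R : realType) (a x g : R) : R :=
  1 / 2 * (a + g) + 1 / 2 * Num.sqrt ((a - g) ^+ 2 + 2 * g * x).

(** From [a] on, the square is nondecreasing in [g]. Strictness comes from [x] alone, since
    [g >= a > 0]; the modified marginal cost thus increases strictly even where the cost is
    linear. *)
Lemma radicand_ltr (R : realType) (a x x' g g' : R) :
  0 < a -> a <= g -> g <= g' -> 0 <= x -> x < x' ->
  (a - g) ^+ 2 + 2 * g * x < (a - g') ^+ 2 + 2 * g' * x'.
Proof.
move=> a0 ag gg x0 xx.
have H1 : (a - g) ^+ 2 <= (a - g') ^+ 2.
  by rewrite -sqrrN -[leRHS]sqrrN ler_sqr ?nnegrE; lra.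
have H2 : g * x < g' * x'.
  apply: (@le_lt_trans _ _ (g' * x)); first by rewrite ler_wpM2r.
  by rewrite ltr_pM2l//; lra.
lra.
Qed.

Lemma marginal_ltr (R : realType) (a x x' g g' : R) :
  0 < a -> a <= g -> g <= g' -> 0 <= x -> x < x' ->
  marginal a x g < marginal a x' g'.
Proof.
move=> a0 ag gg x0 xx; rewrite /marginal.
have := ltW (radicand_ltr a0 ag gg x0 xx); move/ler_wsqrtr.
have := radicand_ltr a0 ag gg x0 xx.
rewrite -ltr_sqrt; first by move=> H _; lra.
apply: le_lt_trans (radicand_ltr a0 ag gg x0 xx).
by rewrite addr_ge0 ?sqr_ge0// !mulr_ge0//; lra.
Qed.

Lemma marginal_gt0 (R : realType) (a x g : R) :
  0 < a -> a <= g -> 0 < marginal a x g.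
Proof.
move=> a0 ag; rewrite /marginal.
by have := sqrtr_ge0 ((a - g) ^+ 2 + 2 * g * x); lra.
Qed.

(** In this lemma and the next three, [(2v - a - g)^2] minus the radicand is twice
    [v(2v - 2a) - g(2v - 2a + x)]. Here the bound on [g] makes [2v - a - g] nonnegative, so the
    squares can be compared. *)
Lemma marginal_le (R : realType) (a x g v : R) :
  0 <= a -> g <= 2 * v - 2 * a ->
  g * (2 * v - 2 * a + x) <= v * (2 * v - 2 * a) -> marginal a x g <= v.
Proof.
move=> a0 gv foc; rewrite /marginal.
suff : Num.sqrt ((a - g) ^+ 2 + 2 * g * x) <= 2 * v - a - g by lra.
rewrite -(@ger0_norm _ (2 * v - a - g)); last by lra.
by rewrite -sqrtr_sqr ler_wsqrtr//; nra.
Qed.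

Lemma marginal_ge (R : realType) (a x g v : R) :
  v * (2 * v - 2 * a) <= g * (2 * v - 2 * a + x) -> v <= marginal a x g.
Proof.
move=> foc; rewrite /marginal.
suff : 2 * v - a - g <= Num.sqrt ((a - g) ^+ 2 + 2 * g * x) by lra.
rewrite (le_trans (ler_norm _))//.
by rewrite -sqrtr_sqr ler_wsqrtr//; nra.
Qed.

Lemma marginal_le_foc (R : realType) (a x g v : R) : 0 <= g -> 0 <= x ->
  marginal a x g <= v -> g * (2 * v - 2 * a + x) <= v * (2 * v - 2 * a).
Proof.
move=> g0 x0; rewrite /marginal => H.
have H1 : Num.sqrt ((a - g) ^+ 2 + 2 * g * x) <= 2 * v - a - g by lra.
have r0 : 0 <= (a - g) ^+ 2 + 2 * g * x.
  by rewrite addr_ge0 ?sqr_ge0 ?mulr_ge0.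
have := sqr_sqrtr r0; have := sqrtr_ge0 ((a - g) ^+ 2 + 2 * g * x).
set r := Num.sqrt _ in H1 *; nra.
Qed.

(** Lying below the larger root is not enough, as [v] could be below the smaller one too. The bound
    [2a - x <= v] excludes this: if the conclusion fails, it gives [g < 2v - 2a], which puts [v]
    beyond the larger root. *)
Lemma marginal_ge_foc (R : realType) (a x g v : R) : 0 <= a -> 0 <= g ->
  0 < v -> 2 * a - x <= v ->
  v <= marginal a x g -> v * (2 * v - 2 * a) <= g * (2 * v - 2 * a + x).
Proof.
move=> a0 g0 v0 xv vm; rewrite leNgt; apply/negP => H.
have gv : g < 2 * v - 2 * a.
  by rewrite -(ltr_pM2l v0); apply: le_lt_trans H; nra.
move: vm; rewrite leNgt => /negP; apply; rewrite /marginal.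
suff : Num.sqrt ((a - g) ^+ 2 + 2 * g * x) < 2 * v - a - g by lra.
rewrite -(@ger0_norm _ (2 * v - a - g)); last by lra.
rewrite -sqrtr_sqr ltr_sqrt; first by nra.
by rewrite exprn_gt0//; lra.
Qed.

(** The derivative of the modified cost, in the sense of [modified_cost_bounds]. *)
Definition virtual_marginal (R : realType) (N : nat) (u : R) (D : 'I_N -> R)
    (c : 'I_N -> R -> R) (n : 'I_N) (z : R) : R :=
  marginal (share D n * u / 2) (z * u / \sum_i D i) (right_deriv (c n) z).

Lemma right_deriv_nondecreasing (R : realType) (c : R -> R) :
  @convex_function R R^o [set x | 0 <= x] c ->
  (forall x y, 0 <= x -> x < y -> c x < c y) ->
  forall s t, 0 <= s -> s <= t -> right_deriv c s <= right_deriv c t.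
Proof.
move=> cvx inc s t s0; rewrite le_eqVlt => /predU1P[->//|st].
have /andP[h1 h2] := convex_right_deriv_bounds cvx inc s0 st.
by have := le_trans h1 h2; rewrite ler_pM2r// subr_gt0.
Qed.

(** The three terms are bounded separately: the linear one exactly, [c n] by its right derivatives,
    and the integral by monotonicity of the integrand. *)
Lemma modified_cost_bounds (R : realType) (N : nat) (u : R) (D : 'I_N -> R)
    (c : 'I_N -> R -> R) (n : 'I_N) (s t : R) :
  0 < share D n * u -> 0 < u / \sum_i D i ->
  @convex_function R R^o [set x | 0 <= x] (c n) ->
  (forall x y, 0 <= x -> x < y -> c n x < c n y) ->
  share D n * u / 2 <= right_deriv (c n) 0 ->
  0 <= s -> s < t ->
  virtual_marginal u D c n s * (t - s)
    <= modified_cost u D c n t - modified_cost u D c n s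
    <= virtual_marginal u D c n t * (t - s).
Proof.
move=> a0 uT cvx inc d0 s0 st.
have t0 : 0 <= t by lra.
have /andP[l1 l2] := convex_right_deriv_bounds cvx inc s0 st.
pose f (z : R) := Num.sqrt ((share D n * u / 2 - right_deriv (c n) z) ^+ 2
                  + 2 * right_deriv (c n) z * (z * u / \sum_i D i)).
have fnd (x y : R) : 0 <= x -> x <= y -> f x <= f y.
  move=> x0; rewrite le_eqVlt => /predU1P[->//|xy]; apply: ler_wsqrtr.
  apply/ltW/radicand_ltr; first by lra.
  - by apply: le_trans d0 _; exact: right_deriv_nondecreasing.
  - by apply: right_deriv_nondecreasing => //; exact: ltW.
  - by rewrite -mulrA mulr_ge0// ltW.
  - by rewrite -!mulrA ltr_pM2r.
have /andP[i1 i2] := nondecreasing_Rintegral_bounds fnd s0 st.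
rewrite /modified_cost /virtual_marginal /marginal -/(f s) -/(f t).
rewrite -/f ltNge t0/= ltNge s0/=.
by apply/andP; split; lra.
Qed.

Lemma affine_le_at_right (R : realType) (p q r a b : R) : a < b ->
  (forall x, a < x < b -> p + q * x <= r) -> p + q * a <= r.
Proof.
move=> ab H.
apply: (@le_at_right_limit _ (fun x => p + q * x) (cst r) a b _ _ ab H).
  by apply: continuousD; [exact: cst_continuous|apply: continuousM;
    [exact: cst_continuous|exact: cvg_id]].
exact: cst_continuous.
Qed.

Lemma affine_le_at_left (R : realType) (p q r a b : R) : a < b ->
  (forall x, a < x < b -> p + q * x <= r) -> p + q * b <= r.
Proof.
move=> ab H.
apply: (@le_at_left_limit _ (fun x => p + q * x) (cst r) a b _ _ ab H).
  by apply: continuousD; [exact: cst_continuous|apply: continuousM;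
    [exact: cst_continuous|exact: cvg_id]].
exact: cst_continuous.
Qed.

(** * Thresholds of increasing functions *)

Section Threshold.
Context (R : realType).
Implicit Types (F phi : R -> R) (D v s t : R).

(** No condition is put on [phi s], as [phi] may jump across [v] there. At [s = 0] or [s = D] one
    clause is vacuous, which covers the corner conditions without multipliers. *)
Definition is_threshold phi D v s :=
  [/\ 0 <= s <= D, forall z, 0 <= z < s -> phi z <= v
    & forall z, s < z <= D -> v <= phi z].

(** Slopes of [F] are on the right side of [v] all the way between [t] and [s], and strictly so on
    the half next to [t], by strict monotonicity of [phi]. *)
Lemma threshold_strict_max F phi D v s t :
  (forall x y, 0 <= x -> x < y -> phi x < phi y) ->
  (forall x y, 0 <= x -> x < y ->
     phi x * (y - x) <= F y - F x <= phi y * (y - x)) ->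
  is_threshold phi D v s -> 0 <= t <= D -> t != s ->
  v * (t - s) < F t - F s.
Proof.
move=> inc bnd [/andP[s0 sD] lo hi] /andP[t0 tD]; rewrite neq_lt => /orP[ts|st].
- pose m := (t + s) / 2.
  have tm : t < m by rewrite /m; lra.
  have ms : m < s by rewrite /m; lra.
  have m0 : 0 <= m by lra.
  have pm : phi m < v.
    apply: (@lt_le_trans _ _ (phi ((m + s) / 2))); first by apply: inc; lra.
    by apply: lo; lra.
  have /andP[_ b1] := bnd _ _ t0 tm.
  have b2 : F s - F m <= v * (s - m).
    (* The value [phi s] may exceed [v], so it is used only on [[x, s]]; the resulting bound is
       affine in [x], and [x] tends to [s]. *)
    suff : (F s - F m - phi s * s + v * m) + (phi s - v) * s <= 0 by lra.
    apply: (@affine_le_at_left _ _ _ _ m) => // x /andP[mx xs].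
    have /andP[_ b3] := bnd _ _ (le_trans m0 (ltW mx)) xs.
    have /andP[_ b4] := bnd _ _ m0 mx.
    have : phi x * (x - m) <= v * (x - m).
      by rewrite ler_pM2r; [apply: lo; lra|lra].
    by lra.
  have : phi m * (m - t) < v * (m - t) by rewrite ltr_pM2r//; lra.
  by lra.
- pose m := (t + s) / 2.
  have tm : m < t by rewrite /m; lra.
  have ms : s < m by rewrite /m; lra.
  have m0 : 0 <= m by lra.
  have pm : v < phi m.
    apply: (@le_lt_trans _ _ (phi ((m + s) / 2))); last by apply: inc; lra.
    by apply: hi; lra.
  have /andP[b1 _] := bnd _ _ m0 tm.
  have b2 : v * (m - s) <= F m - F s.
    suff : (v * m - phi s * s) + (phi s - v) * s <= F m - F s by lra.
    apply: (@affine_le_at_right _ _ _ _ _ m) => // x /andP[sx xm].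
    have /andP[b3 _] := bnd _ _ s0 sx.
    have /andP[b4 _] := bnd _ _ (le_trans s0 (ltW sx)) xm.
    have : v * (m - x) <= phi x * (m - x).
      by rewrite ler_pM2r; [apply: hi; lra|lra].
    by lra.
  have : v * (t - m) < phi m * (t - m) by rewrite ltr_pM2r//; lra.
  by lra.
Qed.

(** If [s' < s], the two points at thirds between them give [v' <= phi _ < phi _ <= v]. With
    [v = v'] this yields uniqueness of the threshold. *)
Lemma threshold_nondecreasing phi D v v' s s' :
  (forall x y, 0 <= x -> x < y -> phi x < phi y) ->
  is_threshold phi D v s -> is_threshold phi D v' s' -> v <= v' -> s <= s'.
Proof.
move=> inc [/andP[s0 sD] lo _] [/andP[s0' sD'] _ hi] vv.
rewrite leNgt; apply/negP => ss.
have := inc ((2 * s' + s) / 3) ((s' + 2 * s) / 3) ltac:(lra) ltac:(lra).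
have := hi ((2 * s' + s) / 3) ltac:(lra).
have := lo ((s' + 2 * s) / 3) ltac:(lra).
lra.
Qed.

Lemma threshold_exists phi D v :
  (forall x y, 0 <= x -> x < y -> phi x < phi y) -> 0 <= D ->
  exists s, is_threshold phi D v s.
Proof.
move=> inc D0.
(* The alternative [z = 0] keeps the set nonempty when [phi] exceeds [v] everywhere; the threshold
   is then 0. *)
pose E := [set z | 0 <= z <= D /\ (z = 0 \/ phi z <= v)].
have E0 : E 0 by split; [rewrite lexx|left].
have ubE : has_ubound E by exists D => z [/andP[]].
have supE : has_sup E by split => //; exists 0.
exists (sup E); split.
- apply/andP; split; first exact: ub_le_sup.
  by apply: ge_sup; [exists 0|move=> z [/andP[]]].
- move=> z /andP[z0 zs].
  have [e [/andP[e0 eD] ev] ze] := @sup_adherent _ E (sup E - z) ltac:(lra) supE.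
  have {}ze : z < e by lra.
  case: ev => [e00|ev]; first by lra.
  by apply: le_trans ev; apply/ltW/inc.
- move=> z /andP[sz zD]; rewrite leNgt; apply/negP => pz.
  have s0 : 0 <= sup E by exact: ub_le_sup.
  have : z <= sup E.
    by apply: ub_le_sup => //; split; [lra|right; exact: ltW].
  by lra.
Qed.

(** A jump of [S] would need [phi] to be constant on an interval. Concretely,
    [v < phi (S v + e / 2)] persists for nearby [w] and prevents [S w] from exceeding [S v + e]; the
    lower side is symmetric. *)
Lemma threshold_continuous phi D (S : R -> R) :
  (forall x y, 0 <= x -> x < y -> phi x < phi y) ->
  (forall v, is_threshold phi D v (S v)) -> continuous S.
Proof.
move=> inc thr v; apply/cvgrPdist_le => e e0.
have [/andP[s0 sD] lo hi] := thr v.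
have up : \forall w \near v, S w <= S v + e.
  have [Ds|sD'] := leP D (S v + e).
    by near=> w; have [/andP[_ wD] _ _] := thr w; exact: le_trans wD Ds.
  have : v < phi (S v + e / 2).
    apply: (@le_lt_trans _ _ (phi (S v + e / 4))); first by apply: hi; lra.
    by apply: inc; lra.
  move=> vp; near=> w; rewrite leNgt; apply/negP => Sw.
  have [_ low _] := thr w.
  have := low (S v + e / 2) ltac:(lra).
  by apply/negP; rewrite -ltNge; near: w; exact: lt_nbhsl.
have down : \forall w \near v, S v - e <= S w.
  have [Ds|sD'] := leP (S v - e) 0.
    by near=> w; have [/andP[w0 _] _ _] := thr w; exact: le_trans Ds w0.
  have : phi (S v - e / 2) < v.
    apply: (@lt_le_trans _ _ (phi (S v - e / 4))); last by apply: lo; lra.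
    by apply: inc; lra.
  move=> vp; near=> w; rewrite leNgt; apply/negP => Sw.
  have [_ _ hiw] := thr w.
  have := hiw (S v - e / 2) ltac:(lra).
  by apply/negP; rewrite -ltNge; near: w; exact: lt_nbhsr.
near=> w; rewrite ler_distl.
have h1 : S w <= S v + e by near: w.
have h2 : S v - e <= S w by near: w.
by lra.
Unshelve. all: by end_near. Qed.

(** The intermediate value theorem applies to [h] on [[0, T]]: positivity of [phi n 0] forces all
    thresholds at value 0 to vanish, so [h 0 = - T < 0], while [h T] is a sum of thresholds. *)
Lemma threshold_fixed_point (N : nat) (phi : 'I_N -> R -> R) (D : 'I_N -> R)
    (tau : R) :
  (forall n x y, 0 <= x -> x < y -> phi n x < phi n y) ->
  (forall n, 0 < phi n 0) -> (forall n, 0 <= D n) -> 0 < \sum_n D n ->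
  exists y (s : 'I_N -> R), [/\ 0 < y, y = \sum_n (D n - s n) &
    forall n, is_threshold (phi n) (D n) (tau * y) (s n)].
Proof.
move=> inc phi0 D0 T0.
pose S n v := sval (cid (@threshold_exists (phi n) (D n) v (inc n) (D0 n))).
have thr n v : is_threshold (phi n) (D n) v (S n v) by exact: svalP (cid _).
pose T := \sum_n D n.
pose h y := y - \sum_n (D n - S n (tau * y)).
have cS n : continuous (fun y => D n - S n (tau * y)).
  move=> y; apply: cvgB; first exact: cvg_cst.
  apply: (@continuous_comp _ _ _ (fun y => tau * y) (S n)).
    by apply: cvgM; [exact: cvg_cst|exact: cvg_id].
  exact: (threshold_continuous (inc n) (thr n)).
have ch : continuous h.
  move=> y; apply: cvgB; first exact: cvg_id.
  by apply: cvg_big => [|n _]; [exact: add_continuous|exact: cS].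
have h0 : h 0 = - T.
  rewrite /h /T mulr0 sub0r; congr (- _); apply: eq_bigr => n _.
  have [/andP[S0 _] lo _] := thr n 0.
  suff -> : S n 0 = 0 by rewrite subr0.
  apply/eqP; rewrite eq_le S0 andbT leNgt; apply/negP => Sgt.
  by have := lo 0; rewrite lexx Sgt => /(_ erefl); rewrite leNgt phi0.
have hT : 0 <= h T.
  rewrite /h /T sumrB opprB addrC subrK sumr_ge0// => n _.
  by have [/andP[]] := thr n (tau * T).
have h0T : Num.min (h 0) (h T) <= 0 <= Num.max (h 0) (h T).
  by rewrite h0 ge_min le_max hT orbT andbT oppr_le0 ltW.
have [y] := @IVT _ h 0 T 0 (ltW T0) (continuous_subspaceT ch) h0T.
rewrite in_itv/= => /andP[y0 yT] hy0.
exists y, (fun n => S n (tau * y)); split=> [|//|n]; last exact: thr.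
- rewrite lt_neqAle y0 andbT; apply/eqP => y00.
  by move: hy0; rewrite -y00 h0 => /eqP; rewrite oppr_eq0 gt_eqF.
- by move/eqP: hy0; rewrite subr_eq0 => /eqP.
Qed.
End Threshold.

(** * Best responses *)

Section BestResponse.
Context (R : realType).
Implicit Types (c g : R -> R) (D tau y s : R).

(** The constant [w] is the one for which [y' = y] gives back [s]; the identity is
    [s - s' = (y' - y)(1 + w / (y' y))] without denominators. *)
Lemma shifted_supply (D y s y' : R) : 0 < y -> 0 < y' ->
  let w := y ^+ 2 - y * (D - s) in
  (s - (D - y' + w / y')) * (y' * y) = (y' - y) * (y' * y + w).
Proof. by move=> y0 y0' w; rewrite /w; field; rewrite gt_eqF. Qed.

(** The threshold property makes [K / (2y - D + s)] a subgradient of [c] at [s]. Replacing the cost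
    by this linear minorant leaves a polynomial inequality in [y'], which a square settles. *)
Lemma threshold_best_response c g D tau y s :
  0 < tau -> 0 < D -> continuous c -> (forall x, x <= 0 -> c x = 0) ->
  (forall x x', 0 <= x -> x < x' ->
     g x * (x' - x) <= c x' - c x <= g x' * (x' - x)) ->
  (forall x, 0 <= x -> D * tau / 2 <= g x) ->
  0 < y -> D - s <= y ->
  is_threshold (fun z => marginal (D * tau / 2) (z * tau) (g z)) D (tau * y) s ->
  let w := y ^+ 2 - y * (D - s) in
  forall y' s', 0 < y' -> w <= y' ^+ 2 -> s' = D - y' + w / y' ->
  tau * y' * s' - c s' <= tau * y * s - c s.
Proof.
move=> tau0 D0 cc c0 bnd ga y0 sy [/andP[s0 sD] lo hi] w y' s' y0' wy s'E.
have a0 : 0 < D * tau / 2 by have := mulr_gt0 D0 tau0; lra.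
have g0 x : 0 <= x -> 0 <= g x by move=> x0; have := ga _ x0; lra.
(* If [s = 0], then [y >= D]; otherwise the marginal at 0 is at least [D * tau / 2] and at most
   [tau * y]. *)
have yD : 0 <= 2 * y - D.
  have [s00|s_gt0] := leP s 0; first by lra.
  have := lo 0; rewrite lexx s_gt0 => /(_ erefl).
  rewrite /marginal; have := ga _ (lexx 0).
  have := sqrtr_ge0 ((D * tau / 2 - g 0) ^+ 2 + 2 * g 0 * (0 * tau)).
  move=> h1 h2 h3.
  have : tau * D <= tau * (2 * y) by lra.
  by rewrite ler_pM2l// subr_ge0.
pose K := tau * (y * (2 * y - D)).
have K0 : 0 <= K by rewrite !mulr_ge0// ltW.
have foc_lo z : 0 <= z < s -> g z * (2 * y - D + z) <= K.
  move=> zs; have z0 : 0 <= z by case/andP: zs.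
  have := marginal_le_foc (g0 _ z0) (mulr_ge0 z0 (ltW tau0)) (lo _ zs).
  move=> H; rewrite -(ler_pM2l tau0) /K; lra.
have foc_hi z : s < z <= D -> K <= g z * (2 * y - D + z).
  move=> zs; have z0 : 0 <= z by case/andP: zs; lra.
  (* This is the side condition that rules out the smaller root. *)
  have H1 : 2 * (D * tau / 2) - z * tau <= tau * y.
    suff : tau * (D - z) <= tau * y by lra.
    by rewrite ler_pM2l//; case/andP: zs; lra.
  have := marginal_ge_foc (ltW a0) (g0 _ z0) (mulr_gt0 tau0 y0) H1 (hi _ zs).
  move=> H; rewrite -(ler_pM2l tau0) /K; lra.
have s'D : s' <= D.
  suff : w / y' <= y' by rewrite s'E; lra.
  by rewrite ler_pdivrMr// -expr2.
have cpoly (p q : R) : continuous (fun z => p * (q + z)).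
  move=> z; apply: cvgM; first exact: cvg_cst.
  by apply: cvgD; [exact: cvg_cst|exact: cvg_id].
have clin (p q : R) : continuous (fun z => (q - c z) * (p + z)).
  move=> z; apply: cvgM; last by apply: cvgD; [exact: cvg_cst|exact: cvg_id].
  by apply: cvgB; [exact: cvg_cst|exact: cc].
have sub_lo z : 0 <= z -> z < s -> (c s - c z) * (2 * y - D + s) <= K * (s - z).
  move=> z0 zs.
  suff : - K * (- z + s) <= (c z - c s) * (2 * y - D + s) by lra.
  apply: (le_at_left_limit (cpoly (- K) (- z) s) (clin (2 * y - D) (c z) s) zs).
  move=> x /andP[zx xs].
  have x0 : 0 <= x by lra.
  have /andP[_ b] := bnd _ _ z0 zx.
  have : (c x - c z) * (2 * y - D + x) <= g x * (x - z) * (2 * y - D + x).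
    by rewrite ler_wpM2r//; lra.
  have : g x * (2 * y - D + x) * (x - z) <= K * (x - z).
    by rewrite ler_wpM2r//; [lra|apply: foc_lo; rewrite x0].
  by lra.
have subgrad : K * (s' - s) <= (c s' - c s) * (2 * y - D + s).
  have [s's|ss'|->] := ltgtP s' s; last by rewrite !subrr mulr0 mul0r.
    (* Deviations may lead to negative supply, outside the range of convexity; there the cost equals
       [c 0] and [K >= 0] suffices. *)
    have [s'0|s'0] := leP 0 s'; first by have := sub_lo _ s'0 s's; lra.
    have cs : (c s - c 0) * (2 * y - D + s) <= K * (s - 0).
      have [s00|s_gt0] := leP s 0; last exact: sub_lo.
      have -> : s = 0 by lra.
      by rewrite !subrr mul0r mulr0.
    rewrite (c0 _ (ltW s'0)); rewrite (c0 _ (lexx 0)) in cs.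
    by have : K * s' <= 0 := mulr_ge0_le0 K0 (ltW s'0); lra.
  suff : - K * (- s' + s) <= (c s' - c s) * (2 * y - D + s) by lra.
  apply: (le_at_right_limit (cpoly (- K) (- s') s) (clin (2 * y - D) (c s') s) ss').
  move=> x /andP[sx xs'].
  have x0 : 0 <= x by lra.
  have /andP[b _] := bnd _ _ x0 xs'.
  have : g x * (s' - x) * (2 * y - D + x) <= (c s' - c x) * (2 * y - D + x).
    by rewrite ler_wpM2r//; lra.
  have : K * (s' - x) <= g x * (2 * y - D + x) * (s' - x).
    by rewrite ler_wpM2r//; [lra|apply: foc_hi; lra].
  by lra.
have e0 : 0 < 2 * y - D + s by lra.
suff H : tau * (y' * s' - y * s) * (2 * y - D + s) <= K * (s' - s).
  have := le_trans H subgrad; rewrite ler_pM2r//; lra.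
rewrite /K -!mulrA ler_pM2l//.
rewrite -(ler_pM2r (mulr_gt0 y0' y0)).
have w0 : 0 <= w.
  have -> : w = y * (y - (D - s)) by rewrite /w; ring.
  by rewrite mulr_ge0 ?subr_ge0// ltW.
have E := shifted_supply D s y0 y0'.
rewrite /= -/w -s'E in E.
have F : y' * s' = D * y' - y' ^+ 2 + w by rewrite s'E; field; rewrite gt_eqF.
have e1 : y * (2 * y - D + s) = y ^+ 2 + w by rewrite /w; ring.
have -> : y * ((2 * y - D) * (s' - s)) * (y' * y) =
   y * (2 * y - D) * - ((s - s') * (y' * y)) by ring.
rewrite E F.
have -> : (D * y' - y' ^+ 2 + w - y * s) * (2 * y - D + s) * (y' * y) =
  (D * y' - y' ^+ 2 + w - y * s) * y' * (y * (2 * y - D + s)) by ring.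
rewrite e1.
have -> : y * s = D * y - y ^+ 2 + w by rewrite /w; ring.
(* This product is exactly the right side of the goal minus the left side. *)
have : 0 <= (y' - y) ^+ 2 * ((2 * y - D) * w + (y ^+ 2 + w) * y').
  rewrite mulr_ge0 ?sqr_ge0// addr_ge0// ?mulr_ge0//; last exact: ltW.
  by rewrite addr_ge0// sqr_ge0.
by lra.
Qed.

(** Small deviations of [y'] to either side of [y] are compared with [gain]. Dividing by [y' - y]
    and letting [y'] tend to [y] bounds [g z] from above for [z < s] and from below for [z > s]. *)
Lemma best_response_threshold c g D tau y s :
  0 < tau -> 0 < D -> (forall x, x <= 0 -> c x = 0) ->
  (forall x x', 0 <= x -> x < x' ->
     g x * (x' - x) <= c x' - c x <= g x' * (x' - x)) ->
  (forall x x', 0 <= x -> x <= x' -> g x <= g x') ->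
  (forall x, 0 <= x -> 0 <= g x) ->
  0 < y -> D - s <= y -> s <= D ->
  let w := y ^+ 2 - y * (D - s) in
  (forall y' s', 0 < y' -> w <= y' ^+ 2 -> s' = D - y' + w / y' ->
    tau * y' * s' - c s' <= tau * y * s - c s) ->
  is_threshold (fun z => marginal (D * tau / 2) (z * tau) (g z)) D (tau * y) s.
Proof.
move=> tau0 D0 c0 bnd gnd g0 y0 sy sD w best.
have a0 : 0 < D * tau / 2 by have := mulr_gt0 D0 tau0; lra.
have wE : w = y * (y - (D - s)) by rewrite /w; ring.
have w0 : 0 <= w by rewrite wE mulr_ge0//; lra.
pose s_ y' := D - y' + w / y'.
have gain y' : 0 < y' -> w <= y' ^+ 2 ->
    tau * ((y - y') * (y' + y - D)) <= c (s_ y') - c s.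
  move=> y0' wy; have := best y' (s_ y') y0' wy erefl => H.
  have F : y' * s_ y' = D * y' - y' ^+ 2 + w.
    by rewrite /s_; field; rewrite gt_eqF.
  have G : y * s = D * y - y ^+ 2 + w by rewrite /w; ring.
  suff : tau * (y' * s_ y' - y * s) <= c (s_ y') - c s.
    by rewrite F G; congr (_ <= _); ring.
  by lra.
(* The square of [y - (D - s) / 2] is [w + (D - s)^2 / 4], so such [y'] correspond to nonnegative
   bids. *)
have feas y' : y - (D - s) / 2 < y' -> 0 < y' /\ w <= y' ^+ 2.
  move=> H; have y0' : 0 < y' by lra.
  split => //; rewrite /w; nra.
have ctn (p q r : R) : continuous (fun x : R => p * x * y * (x + q) + r).
  move=> x; apply: cvgD; last exact: cvg_cst.
  apply: cvgM; last by apply: cvgD; [exact: cvg_id|exact: cvg_cst].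
  apply: cvgM; last exact: cvg_cst.
  by apply: cvgM; [exact: cvg_cst|exact: cvg_id].
have ctn1 (p q : R) : continuous (fun x : R => p * (x * y + q)).
  move=> x; apply: cvgM; first exact: cvg_cst.
  apply: cvgD; last exact: cvg_cst.
  by apply: cvgM; [exact: cvg_id|exact: cvg_cst].
have shift y' := @shifted_supply D y s y' y0.
rewrite /= -/w in shift.
have e1 : y * (2 * y - D + s) = y ^+ 2 + w by rewrite /w; ring.
(* Negative supply is free of cost, so a slightly smaller [y'] would pay more unless its supply were
   already positive; in the limit [y * s >= 0]. *)
have s0 : 0 <= s.
  rewrite leNgt; apply/negP => sn.
  pose m := y - (D - s) / 3.
  have my : m < y by rewrite /m; lra.
  have : (D * y - y ^+ 2 + w) >= 0.
    have cf : continuous (fun x : R => D * x - x ^+ 2 + w).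
      move=> x; apply: cvgD; last exact: cvg_cst.
      apply: cvgB; last by apply: exprn_continuous.
      by apply: cvgM; [exact: cvg_cst|exact: cvg_id].
    apply: (le_at_left_limit (@cst_continuous _ _ 0 y) (cf y) my).
    move=> y' /andP[my' yy'].
    have [y0' wy'] := feas y' ltac:(rewrite /m in my'; lra).
    have := gain _ y0' wy'; rewrite (c0 s (ltW sn)) subr0 => H.
    have : 0 < c (s_ y').
      apply: lt_le_trans H; rewrite mulr_gt0// mulr_gt0//; lra.
    have F : y' * s_ y' = D * y' - y' ^+ 2 + w.
      by rewrite /s_; field; rewrite gt_eqF.
    move=> cpos; rewrite /cst/= -F mulr_ge0// ltW// ltNge; apply/negP => sle.
    by move: cpos; rewrite (c0 _ sle) ltxx.
  have -> : D * y - y ^+ 2 + w = y * s by rewrite /w; ring.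
  by rewrite leNgt pmulr_rlt0// sn.
split; first by rewrite s0.
- move=> z /andP[z0 zs].
  have e0 : 0 < 2 * y - D + s by lra.
  (* Since [s - s_ y'] is at most [(y' - y)(2y - D + s) / y], staying below [M] keeps the supply
     above [z]. *)
  pose M := y + (s - z) * y / (2 * y - D + s).
  have yM : y < M.
    by rewrite /M ltrDl divr_gt0// mulr_gt0// subr_gt0.
  have key : g z * (y * y + w) <= tau * y * y * (y + (y - D)) + 0.
    apply: (le_at_right_limit (ctn1 (g z) w y) (ctn tau (y - D) 0 y) yM).
    move=> y' /andP[yy' y'M].
    have [y0' wy'] := feas y' ltac:(lra).
    have E := shift _ y0'; rewrite -/(s_ y') in E.
    have yy0 := mulr_gt0 y0' y0.
    have d0 : 0 < (y' - y) * (y' * y + w).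
      by rewrite mulr_gt0 ?subr_gt0// ltr_wpDr.
    have ss : s_ y' < s by rewrite -subr_gt0 -(pmulr_lgt0 _ yy0) E.
    have zs' : z < s_ y'.
      suff : s - s_ y' < s - z by lra.
      rewrite -(ltr_pM2r yy0) E.
      have H1 : (y' - y) * (2 * y - D + s) < (s - z) * y.
        by rewrite -ltr_pdivlMr// /M in y'M *; lra.
      have H2 : (y' * y + w) * y <= y' * (y * (2 * y - D + s)).
        rewrite e1; suff : w * y <= w * y' by lra.
        by rewrite ler_wpM2l// ltW.
      rewrite -(ltr_pM2r y0).
      apply: (@le_lt_trans _ _ ((y' - y) * (y' * (y * (2 * y - D + s))))).
        by rewrite -mulrA ler_pM2l// subr_gt0.
      suff : (y' - y) * (2 * y - D + s) * (y' * y) < (s - z) * y * (y' * y) by lra.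
      by rewrite ltr_pM2r.
    have sg0 : 0 <= s_ y' by lra.
    have /andP[b _] := bnd _ _ sg0 ss.
    have G := gain _ y0' wy'.
    have gz : g z * (s - s_ y') <= g (s_ y') * (s - s_ y').
      by rewrite ler_pM2r ?subr_gt0//; apply: gnd => //; exact: ltW.
    have H : g z * (s - s_ y') <= tau * ((y' - y) * (y' + y - D)) by lra.
    move: H; rewrite -(ler_pM2r yy0) -[leLHS]mulrA E => H.
    have yy1 : 0 < y' - y by lra.
    rewrite -(ler_pM2l yy1); lra.
  have {}key : g z * (2 * y - D + s) <= tau * (y * (2 * y - D)).
    rewrite -(ler_pM2l y0).
    have -> : y * (g z * (2 * y - D + s)) = g z * (y ^+ 2 + w) by rewrite -e1; ring.
    by lra.
  have gz0 := g0 _ z0.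
  have gy : g z <= tau * (2 * y - D).
    rewrite -(ler_pM2r y0).
    have : g z * y <= g z * (2 * y - D + s) by rewrite ler_wpM2l//; lra.
    by lra.
  apply: marginal_le; [exact: ltW|lra|].
  have : g z * (2 * y - D + z) <= g z * (2 * y - D + s) by rewrite ler_wpM2l//; lra.
  move=> h; have {h}/(ler_wpM2l (ltW tau0)) := le_trans h key; lra.
- move=> z /andP[sz zD].
  have z0 : 0 <= z by lra.
  (* Above [m] one has [w <= 2 y' y], so the supply moves by at most [3 (y - y') < z - s] and stays
     below [z]. *)
  pose m := y - (z - s) / 3.
  have my : m < y by rewrite /m; lra.
  have key : tau * y * y * (y + (y - D)) + 0 <= g z * (y * y + w).
    apply: (le_at_left_limit (ctn tau (y - D) 0 y) (ctn1 (g z) w y) my).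
    move=> y' /andP[my' yy'].
    have [y0' wy'] := feas y' ltac:(rewrite /m in my'; lra).
    have E := shift _ y0'; rewrite -/(s_ y') in E.
    have yy0 := mulr_gt0 y0' y0.
    have yyw : 0 < y' * y + w by rewrite ltr_wpDr.
    have yy1 : 0 < y - y' by lra.
    have d0 : 0 < (y - y') * (y' * y + w) by rewrite mulr_gt0.
    have {}E : (s_ y' - s) * (y' * y) = (y - y') * (y' * y + w) by lra.
    have ss : s < s_ y' by rewrite -subr_gt0 -(pmulr_lgt0 _ yy0) E.
    have zs' : s_ y' < z.
      suff : s_ y' - s < z - s by lra.
      rewrite -(ltr_pM2r yy0) E.
      have H1 : (y - y') * 3 < z - s by rewrite /m in my'; lra.
      have H2 : w <= 2 * (y' * y).
        rewrite wE; have : y * (y - (D - s)) <= y * (2 * y').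
          by rewrite ler_pM2l//; rewrite /m in my'; lra.
        by lra.
      apply: (@le_lt_trans _ _ ((y - y') * (3 * (y' * y)))).
        by rewrite ler_pM2l//; lra.
      by rewrite [ltLHS]mulrA ltr_pM2r.
    have /andP[_ b] := bnd _ _ s0 ss.
    have G := gain _ y0' wy'.
    have gz : g (s_ y') * (s_ y' - s) <= g z * (s_ y' - s).
      by rewrite ler_pM2r ?subr_gt0//; apply: gnd; [lra|exact: ltW].
    have H : tau * ((y - y') * (y' + y - D)) <= g z * (s_ y' - s) by lra.
    move: H; rewrite -(ler_pM2r yy0) -[leRHS]mulrA E => H.
    rewrite -(ler_pM2l yy1); lra.
  have {}key : tau * (y * (2 * y - D)) <= g z * (2 * y - D + s).
    rewrite -(ler_pM2l y0).
    have -> : y * (g z * (2 * y - D + s)) = g z * (y ^+ 2 + w) by rewrite -e1; ring.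
    by lra.
  apply: marginal_ge.
  have : g z * (2 * y - D + s) <= g z * (2 * y - D + z).
    by rewrite ler_wpM2l//; [exact: g0|lra].
  move=> h; have {h}/(ler_wpM2l (ltW tau0)) := le_trans key h; lra.
Qed.
End BestResponse.

(** * Equilibria and optimality conditions *)

Section Market.
Context (R : realType) (N : nat) (u : R) (D : 'I_N -> R) (c : 'I_N -> R -> R).
Context (u_gt0 : 0 < u) (D_gt0 : forall n, 0 < D n).
Context (T_gt0 : 0 < \sum_i D i).
Context (c_cont : forall n, continuous (c n)).
Context (c_le0 : forall n s, s <= 0 -> c n s = 0).
Context (c_convex : forall n,
  @convex_function R R^o [set x | 0 <= x] (c n)).
Context (c_incr : forall n x y, 0 <= x -> x < y -> c n x < c n y).
Context (c_deriv0 : forall n, share D n * u / 2 <= right_deriv (c n) 0).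

Let T := \sum_i D i.
Let tau := u / T.
Let phi := virtual_marginal u D c.

Let tau_gt0 : 0 < tau. Proof. exact: divr_gt0. Qed.

Let tauT : tau * T = u.
Proof. by rewrite /tau divfK// gt_eqF. Qed.

Let shareE n : share D n * u / 2 = D n * tau / 2.
Proof. by rewrite /share /tau -/T; field; rewrite gt_eqF. Qed.

Let phiE n : phi n =
  fun z => marginal (D n * tau / 2) (z * tau) (right_deriv (c n) z).
Proof.
apply/funext => z; rewrite /phi /virtual_marginal shareE.
by congr (marginal _ _ _); rewrite /tau mulrA.
Qed.

Let right_deriv_ge n x : 0 <= x -> D n * tau / 2 <= right_deriv (c n) x.
Proof.
move=> x0; rewrite -shareE; apply: (le_trans (c_deriv0 n)).
exact: (right_deriv_nondecreasing (@c_convex n) (@c_incr n)).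
Qed.

Let base_gt0 n : 0 < D n * tau / 2.
Proof. by rewrite divr_gt0// mulr_gt0. Qed.

Let phi_incr n x y : 0 <= x -> x < y -> phi n x < phi n y.
Proof.
move=> x0 xy; rewrite phiE; apply: marginal_ltr => //.
- exact: right_deriv_ge.
- by apply: (right_deriv_nondecreasing (@c_convex n) (@c_incr n)) => //; exact: ltW.
- by rewrite mulr_ge0// ltW.
- by rewrite ltr_pM2r.
Qed.

(** * The operator's problem *)

(** With [x = T - d] the profit depends on [x] through [- u (x + y^2 / x)], and the square is
    completed. *)
Lemma operator_profit_reserve (b : 'I_N -> R) (d y : R) :
  \sum_i b i = tau * y ^+ 2 -> d < T ->
  operator_profit u D b d = (u * T + \sum_i b i - 2 * u * y
    - u / (T - d) * (T - d - y) ^+ 2)%:E.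
Proof.
move=> By dT; rewrite /operator_profit dT /clearing_price By -tauT; congr EFin.
have x0 : 0 < T - d by rewrite subr_gt0.
have dE : d = T - (T - d) by ring.
rewrite -/T; move: x0 dE; set x := T - d; clearbody x => x0 ->.
by field; rewrite gt_eqF.
Qed.

(** The subtracted square vanishes only at [T - d = y]; the bound [y <= T] makes this choice
    admissible, and full reduction has profit [-oo]. *)
Lemma operator_best_response (b : 'I_N -> R) (d y : R) :
  \sum_i b i = tau * y ^+ 2 -> 0 < y -> y <= T -> 0 <= d <= T ->
  (forall d', 0 <= d' <= T ->
     (operator_profit u D b d' <= operator_profit u D b d)%E) <-> d = T - y.
Proof.
move=> By y0 yT /andP[d0 dT]; split=> [best|->].
- have dy : T - y < T by lra.
  have := best (T - y) ltac:(lra).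
  rewrite (operator_profit_reserve By dy).
  have [dlt|dge] := ltP d T; last first.
    by rewrite /operator_profit -/T ltNge dge.
  rewrite (operator_profit_reserve By dlt) lee_fin.
  have -> : T - (T - y) - y = 0 by ring.
  rewrite expr0n mulr0 subr0 => H.
  have : u / (T - d) * (T - d - y) ^+ 2 <= 0 by lra.
  rewrite pmulr_rle0; last by rewrite divr_gt0// subr_gt0.
  move=> sq; have /eqP : (T - d - y) ^+ 2 == 0 by rewrite eq_le sq sqr_ge0.
  by move/eqP; rewrite sqrf_eq0 => /eqP; lra.
- move=> d' /andP[d'0 d'T].
  have dy : T - y < T by lra.
  rewrite (operator_profit_reserve By dy).
  have [dlt|dge] := ltP d' T; last first.
    by rewrite /operator_profit -/T ltNge dge leNye.
  rewrite (operator_profit_reserve By dlt) lee_fin.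
  have -> : T - (T - y) - y = 0 by ring.
  rewrite expr0n mulr0 subr0 gerBl.
  by rewrite mulr_ge0 ?sqr_ge0// divr_ge0 ?ltW// subr_gt0.
Qed.

(** * Payoffs and deviations in terms of the unserved capacity *)

(** Once the bids sum to [tau * y^2], every square root is a multiple of [r = sqrt tau] or of its
    inverse. *)
Lemma payoff_reserve (b : 'I_N -> R) (n : 'I_N) (y : R) :
  0 < y -> \sum_i b i = tau * y ^+ 2 ->
  payoff u D c n b = tau * y * (D n - b n / (tau * y))
                     - c n (D n - b n / (tau * y)).
Proof.
move=> y0 By; rewrite /payoff By -/T.
pose r := Num.sqrt tau.
have r0 : 0 < r by rewrite sqrtr_gt0.
have tr : tau = r ^+ 2 by rewrite sqr_sqrtr// ltW.
have -> : Num.sqrt (tau * y ^+ 2) = r * y.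
  by rewrite sqrtrM ?ltW// sqrtr_sqr gtr0_norm.
have -> : Num.sqrt (u * T) = r * T.
  have -> : u * T = tau * T ^+ 2 by rewrite -tauT; ring.
  by rewrite sqrtrM ?ltW// sqrtr_sqr gtr0_norm.
have -> : Num.sqrt (T / u) = r^-1.
  have -> : T / u = tau^-1 by rewrite /tau invf_div.
  by rewrite sqrtrV// ltW.
have -> : D n - b n / (r * y) * r^-1 = D n - b n / (tau * y).
  by rewrite tr; field; rewrite !gt_eqF.
by rewrite tr /share -/T; congr (_ - _); field; rewrite !gt_eqF.
Qed.

Lemma sum_deviation (b : 'I_N -> R) (n : 'I_N) (x : R) :
  \sum_m [eta b with n |-> x] m = \sum_m b m - b n + x.
Proof.
rewrite (bigD1 n)//= eqxx [in RHS](bigD1 n)//=.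
rewrite (eq_bigr b) => [|m mn]; first by ring.
by rewrite (negPf mn).
Qed.

(** The other bids sum to [tau * w], so a bid [x] and the unserved capacity [y'] determine each
    other by [x = tau (y'^2 - w)]; [x >= 0] becomes [w <= y'^2]. *)
Lemma deviation_reserve (b : 'I_N -> R) (y : R) (n : 'I_N) :
  (forall m, 0 <= b m) -> 0 < y -> \sum_i b i = tau * y ^+ 2 ->
  let s := D n - b n / (tau * y) in
  let w := y ^+ 2 - y * (D n - s) in
  (forall x, 0 <= x -> let b' : 'I_N -> R := [eta b with n |-> x] in
     0 < \sum_m b' m -> payoff u D c n b' <= payoff u D c n b) <->
  (forall y' s', 0 < y' -> w <= y' ^+ 2 -> s' = D n - y' + w / y' ->
     tau * y' * s' - c n s' <= tau * y * s - c n s).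
Proof.
move=> b0 y0 By s w.
have wE : tau * w = \sum_i b i - b n.
  by rewrite By /w /s; field; rewrite !gt_eqF.
split=> [best y' s' y'0 wy' s'E|best x x0 b' B'0].
- pose x := tau * (y' ^+ 2 - w).
  have x0 : 0 <= x by rewrite mulr_ge0 ?subr_ge0// ltW.
  have B' : \sum_m [eta b with n |-> x] m = tau * y' ^+ 2.
    by rewrite sum_deviation -wE /x; ring.
  have B'0 : 0 < \sum_m [eta b with n |-> x] m.
    by rewrite B' mulr_gt0// exprn_gt0.
  have := best x x0 B'0.
  rewrite (payoff_reserve n y'0 B') (payoff_reserve n y0 By) /= eqxx.
  suff -> : D n - x / (tau * y') = s' by [].
  by rewrite s'E /x; field; rewrite !gt_eqF.
- pose y' := Num.sqrt ((\sum_m b' m) / tau).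
  have y'0 : 0 < y' by rewrite sqrtr_gt0 divr_gt0.
  have y'2 : y' ^+ 2 = (\sum_m b' m) / tau by rewrite sqr_sqrtr// ltW// divr_gt0.
  have B' : \sum_m b' m = tau * y' ^+ 2 by rewrite y'2; field; rewrite gt_eqF.
  have xE : x = tau * (y' ^+ 2 - w).
    by rewrite mulrBr -B' wE /b' sum_deviation; ring.
  rewrite (payoff_reserve n y'0 B') (payoff_reserve n y0 By).
  have -> : b' n = x by rewrite /b' /= eqxx.
  apply: best => //; last by rewrite xE; field; rewrite !gt_eqF.
  by rewrite -subr_ge0 -(pmulr_rge0 _ tau_gt0) -xE.
Qed.

(* The optimality conditions of the convex program, with [y = T - d] and
   common marginal value [tau * y = u (T - d) / T]. *)
Definition kkt (y : R) (s : 'I_N -> R) :=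
  [/\ 0 < y, y = \sum_n (D n - s n) &
    forall n, is_threshold (phi n) (D n) (tau * y) (s n)].

(** * Existence and uniqueness for the optimality conditions *)

Lemma kkt_exists : exists y s, kkt y s.
Proof.
apply: (@threshold_fixed_point _ _ phi D tau) => // n.
- rewrite phiE; apply: marginal_gt0 => //; exact: right_deriv_ge.
- exact: ltW.
Qed.

(** A larger [y] raises all thresholds and hence lowers [\sum_n (D n - s n)], which is [y]
    itself. *)
Lemma kkt_unique y s y' s' : kkt y s -> kkt y' s' -> y = y' /\ s = s'.
Proof.
have mono a r a' r' : kkt a r -> kkt a' r' -> a <= a' -> forall n, r n <= r' n.
  move=> [_ _ th] [_ _ th'] aa n.
  by apply: threshold_nondecreasing (th n) (th' n) _; [exact: phi_incr|rewrite ler_pM2l].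
have anti a r a' r' : kkt a r -> kkt a' r' -> a <= a' -> a' <= a.
  move=> k k' aa; have [_ -> _] := k; have [_ -> _] := k'.
  by apply: ler_sum => n _; have := mono _ _ _ _ k k' aa n; lra.
move=> k k'.
have yy : y = y'.
  apply/eqP; rewrite eq_le.
  have [h|h] := leP y y'; first by rewrite (anti _ _ _ _ k k' h).
  by have := anti _ _ _ _ k' k (ltW h); rewrite leNgt h.
split => //; apply/funext => n; apply/eqP; rewrite eq_le.
by rewrite (mono _ _ _ _ k k' _ n) ?(mono _ _ _ _ k' k _ n)// yy.
Qed.

(** * Equilibria, optimality conditions and optimal solutions *)

Lemma equilibrium_of_kkt y s : kkt y s ->
  let b n := tau * y * (D n - s n) in
  (\sum_i b i) / T <= u /\ anticipating_equilibrium u D c b (T - y) (tau * y).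
Proof.
move=> [y0 yE th] b.
have By : \sum_i b i = tau * y ^+ 2 by rewrite -mulr_sumr -yE; ring.
have sD n : s n <= D n by have [/andP[]] := th n.
have s0 n : 0 <= s n by have [/andP[]] := th n.
have b0 n : 0 <= b n.
  by rewrite /b mulr_ge0 ?subr_ge0// mulr_ge0// ltW.
have yT : y <= T by rewrite yE; apply: ler_sum => n _; rewrite gerBl.
have B0 : 0 < \sum_i b i by rewrite By mulr_gt0// exprn_gt0.
have Ty : 0 <= T - y <= T by lra.
split.
  rewrite ler_pdivrMr// By /tau -(ler_pM2r T_gt0) -/T.
  have -> : u / T * y ^+ 2 * T = u * y ^+ 2 by field; rewrite gt_eqF.
  by rewrite -mulrA ler_pM2l// expr2 ler_pM// ltW.
split.
- by [].
- move=> n; apply/(deviation_reserve n b0 y0 By).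
  have -> : D n - b n / (tau * y) = s n by rewrite /b; field; rewrite !gt_eqF.
  apply: (@threshold_best_response _ _ (right_deriv (c n))) => //.
  + exact: c_le0.
  + exact: (convex_right_deriv_bounds (@c_convex n) (@c_incr n)).
  + exact: right_deriv_ge.
  + rewrite yE (bigD1 n)//= lerDl sumr_ge0// => m _; by rewrite subr_ge0.
  + by rewrite -phiE.
- rewrite /clearing_price By -/T; field; rewrite gt_eqF//=.
  by have -> : T - (T - y) = y by ring.
- by [].
- by apply/(operator_best_response By y0 yT Ty).
Qed.

Lemma kkt_of_equilibrium b d p :
  (\sum_i b i) / T <= u -> anticipating_equilibrium u D c b d p ->
  exists y s, [/\ kkt y s, b = (fun n => tau * y * (D n - s n)), d = T - y
    & p = tau * y].
Proof.
move=> Bu [[b0 B0] nash pE dT opt].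
pose y := Num.sqrt ((\sum_i b i) / tau).
have y0 : 0 < y by rewrite sqrtr_gt0 divr_gt0.
have By : \sum_i b i = tau * y ^+ 2.
  by rewrite sqr_sqrtr ?divr_ge0 ?ltW//; field; rewrite gt_eqF.
(* In terms of [y], the bound on the bids says exactly this, so the operator's optimum [T - y] is
   admissible. *)
have yT : y <= T.
  have : y ^+ 2 <= T ^+ 2.
    rewrite -(ler_pM2l tau_gt0) -By expr2 mulrA tauT.
    by rewrite -ler_pdivrMr.
  by rewrite ler_sqr// nnegrE ltW.
have dE : d = T - y by exact/(operator_best_response By y0 yT dT).
pose s n := D n - b n / (tau * y).
have ty : 0 < tau * y by rewrite mulr_gt0.
have Ds n : D n - s n = b n / (tau * y) by rewrite /s; ring.
have bE : b = (fun n => tau * y * (D n - s n)).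
  by apply/funext => n; rewrite Ds; field; rewrite !gt_eqF.
exists y, s; split => //.
- split => //.
    rewrite (eq_bigr (fun n => b n / (tau * y))) => [|n _]; last exact: Ds.
    by rewrite -mulr_suml By; field; rewrite !gt_eqF.
  move=> n; rewrite phiE; apply: (@best_response_threshold _ (c n)) => //.
  + exact: c_le0.
  + exact: (convex_right_deriv_bounds (@c_convex n) (@c_incr n)).
  + exact: (right_deriv_nondecreasing (@c_convex n) (@c_incr n)).
  + move=> x x0; apply: le_trans (right_deriv_ge n x0); exact: ltW.
  + rewrite Ds ler_pdivrMr//.
    have -> : y * (tau * y) = \sum_i b i by rewrite By; ring.
    by rewrite (bigD1 n)//= lerDl sumr_ge0.
  + by rewrite -subr_ge0 Ds divr_ge0// ltW.
  + by apply/(deviation_reserve n b0 y0 By); exact: nash.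
- rewrite pE /clearing_price dE By -/T; field; rewrite gt_eqF//=.
  by have -> : T - (T - y) = y by ring.
Qed.

(** The quadratic part of the objective has slope [tau * y] at [T - y]. The loss of any feasible
    point is therefore exactly the sum of the gaps of the modified costs over their tangents plus a
    square, and a gap vanishes only at [s n]. *)
Lemma kkt_optimal y s : kkt y s ->
  optimal u D c s (T - y) /\
  forall s' d', optimal u D c s' d' -> s' = s /\ d' = T - y.
Proof.
move=> [y0 yE th].
have sD n : 0 <= s n <= D n by have [] := th n.
have Ts : \sum_n s n = T - y by rewrite yE sumrB -/T; ring.
have feas : feasible D s (T - y).
  by split => //; rewrite -Ts sumr_ge0// => n _; case/andP: (sD n).
pose gap s' n := modified_cost u D c n (s' n) - modified_cost u D c n (s n)
                 - tau * y * (s' n - s n).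
have strict s' n : 0 <= s' n <= D n -> s' n != s n -> 0 < gap s' n.
  move=> s'D s's; rewrite subr_gt0.
  apply: (threshold_strict_max (@phi_incr n) _ (th n)) => // a b a0 ab.
  apply: modified_cost_bounds (@c_convex n) (@c_incr n) _ a0 ab => //.
  by have := base_gt0 n; rewrite -shareE pmulr_lgt0// invr_gt0.
have gap0 s' n : 0 <= s' n <= D n -> 0 <= gap s' n.
  move=> s'D; have [e|ne] := eqVneq (s' n) (s n).
    by rewrite /gap e !subrr mulr0 subr0.
  exact: ltW (strict _ _ s'D ne).
have objE s' d' : feasible D s' d' ->
    objective u D c s (T - y) - objective u D c s' d' =
    \sum_n gap s' n + tau / 2 * (d' - (T - y)) ^+ 2.
  move=> [sE _ _]; rewrite /gap sumrB sumrB -mulr_sumr sumrB sE Ts.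
  rewrite /objective -/T -tauT; field; rewrite gt_eqF//.
have le_obj s' d' : feasible D s' d' ->
    objective u D c s' d' <= objective u D c s (T - y).
  move=> f; rewrite -subr_ge0 (objE _ _ f) addr_ge0//.
    by apply: sumr_ge0 => n _; apply: gap0; have [_ _] := f.
  by rewrite mulr_ge0 ?sqr_ge0// divr_ge0// ltW.
split; first by split.
move=> s' d' [f opt].
have [sE _ s'D] := f.
have := opt _ _ feas; rewrite -subr_le0 (objE _ _ f) => H.
have sq : 0 <= tau / 2 * (d' - (T - y)) ^+ 2.
  by rewrite mulr_ge0 ?sqr_ge0// divr_ge0// ltW.
have sg : \sum_n gap s' n = 0.
  apply/eqP; rewrite eq_le sumr_ge0 => [|n _]; last exact: gap0.
  by rewrite andbT; lra.
have ss : s' = s.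
  apply/funext => n; apply/eqP/negP => /negP ne.
  have := @psumr_eq0P _ _ xpredT (gap s') (fun n _ => gap0 _ n (s'D n)) sg n isT.
  by apply/eqP; rewrite gt_eqF// strict.
by rewrite ss -sE ss Ts.
Qed.

End Market.

Theorem theorem15 (R : realType) (N : nat) (u : R) (D : 'I_N -> R)
    (c : 'I_N -> R -> R)
    (N_gt0 : (0 < N)%N) (u_gt0 : 0 < u) (D_gt0 : forall n, 0 < D n)
    (c_cont : forall n, continuous (c n))
    (c_le0 : forall n s, s <= 0 -> c n s = 0)
    (c_convex : forall n,
      @convex_function R R^o [set x | 0 <= x] (c n))
    (c_incr : forall n x y, 0 <= x -> x < y -> c n x < c n y)
    (c_deriv0 : forall n, share D n * u / 2 <= right_deriv (c n) 0) :
  (exists! e : ('I_N -> R) * R * R,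
     let '(b, d, p) := e in
     (\sum_i b i) / (\sum_i D i) <= u /\ anticipating_equilibrium u D c b d p)
  /\
  (forall (b : 'I_N -> R) (d p : R),
     (\sum_i b i) / (\sum_i D i) <= u ->
     anticipating_equilibrium u D c b d p ->
     let s := fun n => supply D n (b n) p in
     optimal u D c s d /\
     forall s' d', optimal u D c s' d' -> s' = s /\ d' = d).
Proof.
have T_gt0 : 0 < \sum_i D i.
  rewrite (bigD1 (Ordinal N_gt0))//= ltr_pwDl// sumr_ge0// => n _.
  exact: ltW.
have [y [s k]] := kkt_exists u_gt0 D_gt0 T_gt0 c_convex c_incr c_deriv0.
(* Every admissible equilibrium comes from some solution of the optimality conditions, and that
   solution is the one fixed above. *)
have unique b d p : (\sum_i b i) / (\sum_i D i) <= u ->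
    anticipating_equilibrium u D c b d p ->
    [/\ b = (fun n => u / (\sum_i D i) * y * (D n - s n)),
        d = \sum_i D i - y & p = u / (\sum_i D i) * y].
  move=> Bu eq.
  have [y' [s' [k' -> -> ->]]] := kkt_of_equilibrium u_gt0 D_gt0 T_gt0
    c_le0 c_convex c_incr c_deriv0 Bu eq.
  by have [-> ->] := kkt_unique u_gt0 D_gt0 T_gt0 c_convex c_incr c_deriv0 k k'.
split.
  exists (fun n => u / (\sum_i D i) * y * (D n - s n),
          \sum_i D i - y, u / (\sum_i D i) * y).
  split; first exact: equilibrium_of_kkt k.
  by move=> [[b d] p] [Bu eq]; have [-> -> ->] := unique _ _ _ Bu eq.
move=> b d p Bu eq; have [-> -> ->] := unique _ _ _ Bu eq.
have [y0 _ _] := k.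
have sE : (fun n => supply D n (u / (\sum_i D i) * y * (D n - s n))
                      (u / (\sum_i D i) * y)) = s.
  apply/funext => n; rewrite /supply mulrAC divff ?mul1r; first by ring.
  by rewrite gt_eqF// mulr_gt0// divr_gt0.
by rewrite /= sE; exact: kkt_optimal k.
Qed.
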